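(* Let $p>0$ and let $\mathcal{S}_p=\{x^{-p}e^{ix} : 1<x<\infty\}\subset\mathbb{C}$. For every $\alpha\in\left[\frac{p}{p+1},p\right)\cap(0,1]$ there exists an $\left(\alpha,\frac{p\alpha}{p-\alpha}\right)$-Hölder homeomorphism between $(0,1)$ and $\mathcal{S}_p$ (from $(0,1)$ onto $\mathcal{S}_p$).
   Context: For $X,Y\subset\mathbb{C}$ and $0<\alpha\leq1\leq\beta<\infty$, a homeomorphism $f:X\to Y$ is $(\alpha,\beta)$-Hölder if there is a constant $C>0$ such that $C^{-1}|x-y|^\beta\leq|f(x)-f(y)|\leq C|x-y|^\alpha$ for all $x,y\in X$. (For $\alpha$ in the stated range, $\frac{p\alpha}{p-\alpha}\geq1$.) *)

(* Defs.v *)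
From Stdlib Require Import Reals.
From Coquelicot Require Import Coquelicot.

Open Scope R_scope.

(* [Rpower 0 a = exp (a * ln 0) = 1] in Stdlib, whereas [|x - y| ^ a] must
   vanish when [x = y]; only used for [0 <= x] and [0 < a]. *)
Definition rpow (x a : R) : R :=
  if Req_EM_T x 0 then 0 else Rpower x a.

Definition Cexp (z : C) : C :=
  (exp (Re z) * cos (Im z), exp (Re z) * sin (Im z)).

(* A map [X -> Y] between subsets of the plane is represented by a total
   function whose values outside [X] are irrelevant. *)
Definition homeomorphism (X Y : C -> Prop) (f : C -> C) : Prop :=
  exists g : C -> C,
    (forall x : C, X x -> Y (f x) /\ g (f x) = x) /\
    (forall y : C, Y y -> X (g y) /\ f (g y) = y) /\
    continuous_on X f /\ continuous_on Y g.

Definition holder_homeomorphism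
    (alpha beta : R) (X Y : C -> Prop) (f : C -> C) : Prop :=
  (0 < alpha <= 1 /\ 1 <= beta) /\
  homeomorphism X Y f /\
  exists K : R, 0 < K /\
    forall x y : C, X x -> X y ->
      / K * rpow (Cmod (x - y)%C) beta <= Cmod (f x - f y)%C /\
      Cmod (f x - f y)%C <= K * rpow (Cmod (x - y)%C) alpha.

Definition unit_interval (z : C) : Prop :=
  exists t : R, 0 < t < 1 /\ z = RtoC t.

Definition spiral (p : R) (z : C) : Prop :=
  exists x : R, 1 < x /\ z = (RtoC (Rpower x (- p)) * Cexp (Ci * RtoC x))%C.

(* Main.v *)
(** Put [s = alpha / (p - alpha)], [beta = s p] and parametrize the spiral by
    [f t = t^beta e^(i t^(-s))], i.e. substitute [x = t^(-s)].  For [u < t],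
    the moduli alone give [|f t - f u| >= t^beta - u^beta >= (t - u)^beta],
    because [beta >= 1] (this is where [alpha >= p / (p + 1)] is used).  For
    the upper bound the radial part is Lipschitz, while the angular part is at
    most [u^beta min (2, u^(-s) - t^(-s)) <= 2 u^beta (s u^(-s-1) (t - u))^alpha],
    in which the powers of [u] cancel since [(s + 1) alpha = beta]. *)

Require Import Defs.
From Stdlib Require Import Reals Lra.
From Coquelicot Require Import Coquelicot.

Open Scope R_scope.

(** * Real powers: monotonicity and estimates for differences *)

Lemma Rpower_pos (x a : R) : 0 < Rpower x a.
Proof. apply exp_pos. Qed.

Lemma Rpower_Ropp_r (x a : R) : 0 < x -> Rpower x (- a) = Rpower (/ x) a.
Proof.
  intros hx. unfold Rpower. rewrite ln_Rinv by exact hx. f_equal. ring.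
Qed.

Lemma Rpower_base_1 (a : R) : Rpower 1 a = 1.
Proof. unfold Rpower. rewrite ln_1, Rmult_0_r. apply exp_0. Qed.

Lemma Rpower_le_1 (x a : R) : 0 < x <= 1 -> 0 <= a -> Rpower x a <= 1.
Proof.
  intros hx ha. rewrite <- (Rpower_base_1 a). now apply Rle_Rpower_l.
Qed.

Lemma Rpower_lt_1 (x a : R) : 0 < x < 1 -> 0 < a -> Rpower x a < 1.
Proof.
  intros hx ha. rewrite <- (Rpower_base_1 a). now apply Rlt_Rpower_l.
Qed.

Lemma Rpower_neg_gt_1 (x a : R) : 0 < x < 1 -> a < 0 -> 1 < Rpower x a.
Proof.
  intros hx ha. assert (ln x < 0) by (rewrite <- ln_1; apply ln_increasing; lra).
  rewrite <- exp_0. apply exp_increasing. nra.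
Qed.

Lemma Rpower_antitone_exponent (x a b : R) :
  0 < x <= 1 -> a <= b -> Rpower x b <= Rpower x a.
Proof.
  intros hx hab.
  replace b with (a + (b - a)) by ring. rewrite Rpower_plus.
  rewrite <- (Rmult_1_r (Rpower x a)) at 2.
  apply Rmult_le_compat_l; [left; apply Rpower_pos |].
  apply Rpower_le_1; lra.
Qed.

Lemma Rpower_mult_Rinv (x a : R) : 0 < x -> a <> 0 -> Rpower (Rpower x a) (/ a) = x.
Proof.
  intros hx ha. rewrite Rpower_mult, Rinv_r by exact ha. now apply Rpower_1.
Qed.

Lemma Rpower_mvt (a u t : R) :
  0 < u < t ->
  exists c, u < c < t /\ Rpower t a - Rpower u a = a * Rpower c (a - 1) * (t - u).
Proof.
  intros hut.
  destruct (MVT_cor2 (fun x => Rpower x a) (fun x => a * Rpower x (a - 1)) u t)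
    as [c [hc1 hc2]]; [lra | | now exists c].
  intros c hc. apply derivable_pt_lim_power. lra.
Qed.

(** The fractions [u / t] and [(t - u) / t] lie in (0, 1], where raising to a power [b >= 1] does
    not increase a number, and they add up to 1. *)
Lemma Rpower_superadditive (b u t : R) :
  1 <= b -> 0 < u < t -> Rpower (t - u) b <= Rpower t b - Rpower u b.
Proof.
  intros hb hut.
  assert (H : forall v, 0 < v <= t -> Rpower v b <= Rpower t b * (v / t)).
  { intros v hv.
    assert (hvt : 0 < v / t <= 1).
    { split; [apply Rdiv_lt_0_compat; lra |].
      apply Rmult_le_reg_r with t; [lra |]. field_simplify; lra. }
    replace (Rpower v b) with (Rpower t b * Rpower (v / t) b).
    - apply Rmult_le_compat_l; [left; apply Rpower_pos |].
      rewrite <- (Rpower_1 (v / t)) at 2 by lra.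
      apply Rpower_antitone_exponent; lra.
    - rewrite Rpower_mult_distr by lra. f_equal. field. lra. }
  assert (H1 := H (t - u)). assert (H2 := H u).
  replace (Rpower t b) with (Rpower t b * ((t - u) / t) + Rpower t b * (u / t))
    by (field; lra).
  lra.
Qed.

Lemma Rpower_Lipschitz (b u t : R) :
  1 <= b -> 0 < u < t -> t <= 1 -> Rpower t b - Rpower u b <= b * (t - u).
Proof.
  intros hb hut ht.
  destruct (Rpower_mvt b u t hut) as [c [hc ->]].
  apply Rmult_le_compat_r; [lra |].
  assert (Rpower c (b - 1) <= 1) by (apply Rpower_le_1; lra).
  nra.
Qed.

(** Mean value theorem: the derivative of [x^(-s)] is largest in modulus at the left end [u].
    Evaluating it there lets the powers of [u] cancel in [spiral_param_upper]. *)
Lemma Rpower_neg_diff_le (s u t : R) :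
  0 < s -> 0 < u < t ->
  Rpower u (- s) - Rpower t (- s) <= s * Rpower u (- s - 1) * (t - u).
Proof.
  intros hs hut.
  destruct (Rpower_mvt (- s) u t hut) as [c [hc H]].
  assert (Rpower c (- s - 1) <= Rpower u (- s - 1)).
  { replace (- s - 1) with (- (s + 1)) by ring.
    rewrite !Rpower_Ropp_r by lra.
    apply Rle_Rpower_l; [lra |].
    split; [apply Rinv_0_lt_compat; lra | apply Rinv_le_contravar; lra]. }
  assert (s * Rpower c (- s - 1) * (t - u) <= s * Rpower u (- s - 1) * (t - u)).
  { apply Rmult_le_compat_r; [lra |]. apply Rmult_le_compat_l; lra. }
  lra.
Qed.

(** * Chords of the unit circle *)

Lemma Rabs_sin_le (x : R) : Rabs (sin x) <= Rabs x.
Proof.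
  assert (H : forall y, 0 <= y -> Rabs (sin y) <= y).
  { intros y hy. destruct (Rle_lt_or_eq_dec 0 y hy) as [h | <-].
    - destruct (Rle_lt_dec y 1) as [h1 | h1].
      + assert (hpi := PI2_1).
        rewrite Rabs_pos_eq; [left; now apply sin_lt_x |].
        apply sin_ge_0; lra.
      + assert (hb := SIN_bound y). apply Rabs_le. lra.
    - rewrite sin_0, Rabs_R0. lra. }
  destruct (Rle_lt_dec 0 x) as [h | h].
  - rewrite (Rabs_pos_eq x h). now apply H.
  - rewrite <- (Rabs_Ropp (sin x)), <- sin_neg, (Rabs_left x h). apply H. lra.
Qed.

Lemma Cexp_imaginary (x : R) : Cexp (Ci * RtoC x)%C = (cos x, sin x).
Proof.
  unfold Cexp; simpl.
  replace (0 * x - 1 * 0) with 0 by ring.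
  replace (0 * 0 + 1 * x) with x by ring.
  now rewrite exp_0, !Rmult_1_l.
Qed.

Lemma Cmod_Cexp_imaginary (x : R) : Cmod (Cexp (Ci * RtoC x)) = 1.
Proof.
  rewrite Cexp_imaginary. unfold Cmod; simpl fst; simpl snd.
  replace (cos x ^ 2 + sin x ^ 2) with ((sin x)² + (cos x)²) by (unfold Rsqr; ring).
  rewrite sin2_cos2. apply sqrt_1.
Qed.

(** The squared chord is [2 - 2 cos (x - y)], and the half-angle formula makes it a perfect
    square. *)
Lemma Cmod_Cexp_imaginary_minus (x y : R) :
  Cmod (Cexp (Ci * RtoC x) - Cexp (Ci * RtoC y)) = 2 * Rabs (sin ((x - y) / 2)).
Proof.
  rewrite !Cexp_imaginary. unfold Cmod; simpl fst; simpl snd.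
  replace (2 * Rabs (sin ((x - y) / 2))) with (Rabs (2 * sin ((x - y) / 2)))
    by (rewrite Rabs_mult, (Rabs_pos_eq 2); lra).
  rewrite <- sqrt_Rsqr_abs. f_equal.
  assert (hc : cos (x - y) = 1 - 2 * (sin ((x - y) / 2))²).
  { replace (x - y) with (2 * ((x - y) / 2)) at 1 by field.
    rewrite cos_2a_sin. unfold Rsqr. ring. }
  rewrite cos_minus in hc.
  assert (hx := sin2_cos2 x). assert (hy := sin2_cos2 y).
  unfold Rsqr in *. nra.
Qed.

(** Interpolates between two bounds on the chord: the angle [d = y - x], with [d <= d^a] when
    [d <= 1], and the diameter 2, with [1 <= d^a] when [d > 1]. *)
Lemma Cmod_Cexp_imaginary_minus_le (a x y : R) :
  0 <= a <= 1 -> x < y ->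
  Cmod (Cexp (Ci * RtoC y) - Cexp (Ci * RtoC x)) <= 2 * Rpower (y - x) a.
Proof.
  intros ha hxy. rewrite Cmod_Cexp_imaginary_minus.
  destruct (Rle_lt_dec (y - x) 1) as [h | h].
  - assert (hs := Rabs_sin_le ((y - x) / 2)).
    rewrite (Rabs_pos_eq ((y - x) / 2)) in hs by lra.
    assert (hp := Rpower_antitone_exponent (y - x) a 1).
    rewrite Rpower_1 in hp by lra. lra.
  - assert (hs : Rabs (sin ((y - x) / 2)) <= 1).
    { apply Rabs_le. assert (hb := SIN_bound ((y - x) / 2)). lra. }
    assert (hp := Rle_Rpower_l 1 (y - x) a).
    rewrite Rpower_base_1 in hp. lra.
Qed.

(** * Hölder bounds and continuity *)

Lemma rpow_Rpower (x a : R) : 0 < x -> rpow x a = Rpower x a.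
Proof. intros hx. unfold rpow. destruct (Req_EM_T x 0); lra. Qed.

Lemma rpow_0 (a : R) : rpow 0 a = 0.
Proof. unfold rpow. destruct (Req_EM_T 0 0); lra. Qed.

(** Turns a lower Hölder bound for a map into an upper one for its inverse. *)
Lemma le_rpow_Rinv (x y b : R) :
  0 <= x -> 0 < b -> 0 <= y -> rpow x b <= y -> x <= rpow y (/ b).
Proof.
  intros [hx | <-] hb hy H.
  - rewrite rpow_Rpower in H by exact hx.
    assert (hxb := Rpower_pos x b).
    rewrite rpow_Rpower by lra.
    rewrite <- (Rpower_mult_Rinv x b) at 1 by lra.
    apply Rle_Rpower_l; [left; now apply Rinv_0_lt_compat | lra].
  - unfold rpow. destruct (Req_EM_T y 0); [lra | left; apply Rpower_pos].
Qed.

Lemma Cmod_minus_sym (x y : C) : Cmod (x - y) = Cmod (y - x).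
Proof. rewrite <- Cmod_opp. f_equal. ring. Qed.

Lemma Cmod_minus_ge (x y : C) : Cmod x - Cmod y <= Cmod (x - y).
Proof.
  assert (H := Cmod_triangle (x - y) y).
  replace (x - y + y)%C with x in H by ring. lra.
Qed.

Lemma holder_continuous_on (D : C -> Prop) (f : C -> C) (K a : R) :
  0 < K -> 0 < a ->
  (forall x y, D x -> D y -> Cmod (f x - f y) <= K * rpow (Cmod (x - y)) a) ->
  continuous_on D f.
Proof.
  intros hK ha H x hx.
  apply (filterlim_locally_ball_norm (U := C_NormedModule)).
  intros eps.
  assert (hek : 0 < eps / K) by (apply Rdiv_lt_0_compat; [apply cond_pos | exact hK]).
  unfold within.
  (* The radius [(eps / K)^(1 / a)] solves [K * r^a = eps]. *)
  apply filter_imp with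
    (2 := locally_ball_norm (V := C_NormedModule) x
            (mkposreal (Rpower (eps / K) (/ a)) (Rpower_pos _ _))).
  intros y hxy hy.
  unfold ball_norm in *. simpl in hxy.
  change (Cmod (y - x) < Rpower (eps / K) (/ a)) in hxy.
  change (Cmod (f y - f x) < eps).
  apply Rle_lt_trans with (1 := H y x hy hx).
  replace (pos eps) with (K * (eps / K)) by (field; lra).
  apply Rmult_lt_compat_l; [exact hK |].
  destruct (Cmod_ge_0 (y - x)) as [h | <-]; [| now rewrite rpow_0].
  rewrite rpow_Rpower by exact h.
  rewrite <- (Rpower_1 (eps / K)) by exact hek.
  rewrite <- (Rinv_l a), <- Rpower_mult by lra.
  apply Rlt_Rpower_l; [exact ha | now split].
Qed.

(** * The parametrized spiral and its two-sided Hölder bound *)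

Definition spiral_point (p x : R) : C :=
  (RtoC (Rpower x (- p)) * Cexp (Ci * RtoC x))%C.

Lemma Cmod_spiral_point (p x : R) : Cmod (spiral_point p x) = Rpower x (- p).
Proof.
  unfold spiral_point. rewrite Cmod_mult, Cmod_Cexp_imaginary, Cmod_R, Rmult_1_r.
  apply Rabs_pos_eq. left. apply Rpower_pos.
Qed.

Definition spiral_param (p s t : R) : C := spiral_point p (Rpower t (- s)).

Lemma spiral_param_eq (p s t : R) :
  spiral_param p s t = (RtoC (Rpower t (s * p)) * Cexp (Ci * RtoC (Rpower t (- s))))%C.
Proof.
  unfold spiral_param, spiral_point. rewrite Rpower_mult.
  now replace (- s * - p) with (s * p) by ring.
Qed.

Lemma Cmod_spiral_param (p s t : R) : Cmod (spiral_param p s t) = Rpower t (s * p).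
Proof.
  unfold spiral_param. rewrite Cmod_spiral_point, Rpower_mult. f_equal. ring.
Qed.

Lemma spiral_param_lower (p s u t : R) :
  1 <= s * p -> 0 < u < t ->
  Rpower (t - u) (s * p) <= Cmod (spiral_param p s t - spiral_param p s u).
Proof.
  intros hb hut.
  apply Rle_trans with (1 := Rpower_superadditive _ _ _ hb hut).
  rewrite <- !Cmod_spiral_param. apply Cmod_minus_ge.
Qed.

Lemma spiral_param_upper (p s a u t : R) :
  0 < s -> 1 <= s * p -> 0 < a <= 1 -> (s + 1) * a = s * p -> 0 < u < t -> t <= 1 ->
  Cmod (spiral_param p s t - spiral_param p s u)
    <= (s * p + 2 * Rpower s a) * Rpower (t - u) a.
Proof.
  intros hs hb ha hsa hut ht. rewrite !spiral_param_eq.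
  set (E := fun v => Cexp (Ci * RtoC (Rpower v (- s)))%C).
  fold (E t) (E u).
  (* Radial plus angular part. The angular part gets the weight of the smaller parameter [u], which
     is the one that compensates the factor [u^(-s-1)] from the mean value estimate. *)
  replace (RtoC (Rpower t (s * p)) * E t - RtoC (Rpower u (s * p)) * E u)%C
    with (RtoC (Rpower t (s * p) - Rpower u (s * p)) * E t
          + RtoC (Rpower u (s * p)) * (E t - E u))%C
    by (rewrite RtoC_minus; ring).
  apply Rle_trans with (1 := Cmod_triangle _ _).
  rewrite !Cmod_mult, !Cmod_R, (Cmod_minus_sym (E t)).
  unfold E at 1. rewrite Cmod_Cexp_imaginary, Rmult_1_r.
  rewrite (Rabs_pos_eq (Rpower u _)) by (left; apply Rpower_pos).
  rewrite Rmult_plus_distr_r. apply Rplus_le_compat.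
  - assert (0 < Rpower (t - u) (s * p)) by apply Rpower_pos.
    assert (hsup := Rpower_superadditive _ _ _ hb hut).
    rewrite Rabs_pos_eq by lra.
    apply Rle_trans with (1 := Rpower_Lipschitz _ _ _ hb hut ht).
    apply Rmult_le_compat_l; [lra |].
    (* Since [t - u <= 1], lowering the exponent from 1 to [a] only increases the power. *)
    rewrite <- (Rpower_1 (t - u)) at 1 by lra.
    apply Rpower_antitone_exponent; lra.
  - set (d := Rpower u (- s) - Rpower t (- s)).
    assert (hd : 0 < d).
    { unfold d. rewrite !Rpower_Ropp_r by lra. apply Rlt_0_minus.
      apply Rlt_Rpower_l; [exact hs |].
      split; [apply Rinv_0_lt_compat; lra |].
      apply Rinv_lt_contravar; [nra | lra]. }
    assert (hE : Cmod (E u - E t) <= 2 * Rpower d a)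
      by (apply Cmod_Cexp_imaginary_minus_le; unfold d in hd; lra).
    assert (hda : Rpower d a
                  <= Rpower s a * Rpower u (- (s * p)) * Rpower (t - u) a).
    { replace (- (s * p)) with ((- s - 1) * a) by (rewrite <- hsa; ring).
      rewrite <- (Rpower_mult u).
      assert (0 < Rpower u (- s - 1)) by apply Rpower_pos.
      rewrite !Rpower_mult_distr; try nra.
      apply Rle_Rpower_l; [lra |].
      split; [exact hd | now apply Rpower_neg_diff_le]. }
    replace (2 * Rpower s a * Rpower (t - u) a)
      with (Rpower u (s * p)
            * (2 * (Rpower s a * Rpower u (- (s * p)) * Rpower (t - u) a))).
    + apply Rmult_le_compat_l; [left; apply Rpower_pos | lra].
    + rewrite Rpower_Ropp.
      field. apply Rgt_not_eq, Rpower_pos.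
Qed.

Lemma spiral_param_holder (p s a : R) :
  0 < s -> 1 <= s * p -> 0 < a <= 1 -> (s + 1) * a = s * p ->
  forall x y : C, unit_interval x -> unit_interval y ->
    rpow (Cmod (x - y)) (s * p)
      <= Cmod (spiral_param p s (Re x) - spiral_param p s (Re y)) /\
    Cmod (spiral_param p s (Re x) - spiral_param p s (Re y))
      <= (s * p + 2 * Rpower s a) * rpow (Cmod (x - y)) a.
Proof.
  intros hs hb ha hsa.
  assert (H : forall u t, 0 < u < t -> t <= 1 ->
    rpow (Cmod (t - u)) (s * p)
      <= Cmod (spiral_param p s t - spiral_param p s u) /\
    Cmod (spiral_param p s t - spiral_param p s u)
      <= (s * p + 2 * Rpower s a) * rpow (Cmod (t - u)) a).
  { intros u t hut ht.
    rewrite <- RtoC_minus, Cmod_R, Rabs_pos_eq, !rpow_Rpower by lra.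
    split; [now apply spiral_param_lower | now apply spiral_param_upper]. }
  intros x y [t [ht ->]] [u [hu ->]]. simpl.
  destruct (Rtotal_order t u) as [h | [<- | h]].
  - rewrite (Cmod_minus_sym t), (Cmod_minus_sym (spiral_param _ _ t)). apply H; lra.
  - replace (t - t)%C with (RtoC 0) by ring.
    replace (spiral_param p s t - spiral_param p s t)%C with (RtoC 0) by ring.
    rewrite Cmod_0, !rpow_0. lra.
  - apply H; lra.
Qed.

Theorem corollary2p4 (p : R) (hp : 0 < p) (alpha : R)
    (h1 : p / (p + 1) <= alpha < p) (h2 : 0 < alpha <= 1) :
  exists f : C -> C,
    holder_homeomorphism alpha (p * alpha / (p - alpha))
      unit_interval (spiral p) f.
Proof.
  set (s := alpha / (p - alpha)).
  assert (hs : 0 < s) by (apply Rdiv_lt_0_compat; lra).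
  replace (p * alpha / (p - alpha)) with (s * p) by (unfold s; field; lra).
  assert (hsa : (s + 1) * alpha = s * p) by (unfold s; field; lra).
  assert (hb : 1 <= s * p).
  { assert (p <= alpha * (p + 1)).
    { replace p with (p / (p + 1) * (p + 1)) at 1 by (field; lra).
      apply Rmult_le_compat_r; lra. }
    apply Rmult_le_reg_r with (p - alpha); [lra |].
    unfold s. field_simplify; lra. }
  assert (hH := spiral_param_holder p s alpha hs hb h2 hsa).
  set (f := fun z : C => spiral_param p s (Re z)) in *.
  assert (hfY : forall x, unit_interval x -> spiral p (f x)).
  { intros x [t [ht ->]]. exists (Rpower t (- s)). split; [| reflexivity].
    apply Rpower_neg_gt_1; lra. }
  (* The modulus of [f t] is [t^(s p)], so the modulus alone recovers [t]. *)
  set (g := fun z : C => RtoC (Rpower (Cmod z) (/ (s * p)))).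
  assert (hgf : forall x, unit_interval x -> g (f x) = x).
  { intros x [t [ht ->]]. unfold g, f. simpl.
    rewrite Cmod_spiral_param, Rpower_mult_Rinv by lra. reflexivity. }
  assert (hg : forall y, spiral p y -> unit_interval (g y) /\ f (g y) = y).
  { intros y [x [hx hy]]. fold (spiral_point p x) in hy.
    assert (hgy : g y = RtoC (Rpower x (- / s))).
    { unfold g. rewrite hy, Cmod_spiral_point, Rpower_mult.
      do 2 f_equal. field. lra. }
    rewrite hgy. split.
    - exists (Rpower x (- / s)). split; [split; [apply Rpower_pos |] | reflexivity].
      rewrite <- (Rpower_O x) by lra. apply Rpower_lt; [exact hx |].
      assert (0 < / s) by now apply Rinv_0_lt_compat. lra.
    - unfold f, spiral_param. simpl. rewrite Rpower_mult, hy.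
      replace (- / s * - s) with 1 by (field; lra).
      rewrite Rpower_1 by lra. reflexivity. }
  assert (hs' := Rpower_pos s alpha).
  exists f. split; [lra | split].
  - exists g. split; [| split; [exact hg | split]].
    + intros x hx. split; [now apply hfY | now apply hgf].
    + apply holder_continuous_on with (s * p + 2 * Rpower s alpha) alpha; [lra | lra |].
      intros x y hx hy. now apply hH.
    (* The lower bound for [f], read at [g x] and [g y], makes [g] Hölder with exponent [1 / (s p)]
       and constant 1. *)
    + apply holder_continuous_on with 1 (/ (s * p)); [lra | apply Rinv_0_lt_compat; lra |].
      intros x y hx hy. rewrite Rmult_1_l.
      destruct (hg x hx) as [hgx hfx]. destruct (hg y hy) as [hgy hfy].
      apply le_rpow_Rinv; [apply Cmod_ge_0 | lra | apply Cmod_ge_0 |].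
      rewrite <- hfx, <- hfy at 2. now apply hH.
  (* The lower bound holds with constant 1, and this upper constant is at least 1, so its inverse
     also serves below. *)
  - exists (s * p + 2 * Rpower s alpha). split; [lra |].
    intros x y hx hy. destruct (hH x y hx hy) as [hlo hup]. split; [| exact hup].
    apply Rle_trans with (2 := hlo).
    assert (0 <= rpow (Cmod (x - y)) (s * p)).
    { unfold rpow. destruct (Req_EM_T _ 0); [lra | left; apply Rpower_pos]. }
    assert (/ (s * p + 2 * Rpower s alpha) <= 1)
      by (rewrite <- Rinv_1; apply Rinv_le_contravar; lra).
    nra.
Qed.
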